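(* Let $K$ be a simplicial complex on $[r]=\{1,\dots,r\}$ and let $S$ be the set of all maximal simplices of $K$. Then $\mathrm{cat}_{\mathbb{Z}_2^r}(\mathbb{R}\mathcal{Z}_K)=|S|$.
   Context: For a simplicial complex $K$ with vertex set $[r]$ and a simplex $\sigma\in K$, put $(D^1,S^0)^\sigma=\{(x_1,\dots,x_r)\in(D^1)^r \mid x_i\in S^0 \text{ when } i\notin\sigma\}$, where $D^1=[-1,1]$ and $S^0=\{-1,1\}$. The real moment angle complex of $K$ is $\mathbb{R}\mathcal{Z}_K=\bigcup_{\sigma\in K}(D^1,S^0)^\sigma\subseteq(D^1)^r$, with the subspace topology and the $\mathbb{Z}_2^r$-action induced from the coordinatewise sign action of $\mathbb{Z}_2^r$ on $(D^1)^r$. Equivariant LS-category: let $G$ be a compact topological group acting continuously on a Hausdorff space $Y$. A $G$-invariant open subset $U\subseteq Y$ is $G$-categorical if there is a $G$-equivariant homotopy $H\colon U\times I\to Y$ (i.e. $gH(y,t)=H(gy,t)$) with $H_0$ the inclusion and the image of $H_1$ contained in a single $G$-orbit. $\mathrm{cat}_G(Y)$ is the least positive number of $G$-categorical invariant open sets required to cover $Y$ ($\infty$ if no such cover exists). *)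

(* Defs.v *)
From HB Require Import structures.
From mathcomp Require Import all_boot all_order all_algebra.
From mathcomp Require Import all_classical all_reals all_analysis.
Set Implicit Arguments.
Unset Strict Implicit.
Unset Printing Implicit Defensive.
Import Order.TTheory GRing.Theory Num.Theory.
Import numFieldNormedType.Exports.
Local Open Scope classical_set_scope.
Local Open Scope ring_scope.

HB.mixin Record isTopologicalGroup G & Group G & Topological G := {
  mulg_continuous : continuous (fun p : G * G => (p.1 * p.2)%g);
  invg_continuous : continuous (fun g : G => g^-1%g)
}.

#[short(type="topologicalGroupType")]
HB.structure Definition TopologicalGroup :=
  {G of Group G & Topological G & isTopologicalGroup G}.

Record continuous_action (G : topologicalGroupType) (Y : topologicalType) := {
  act :> G -> Y -> Y;
  act_one : forall y, act 1%g y = y;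
  act_mul : forall g h y, act (g * h)%g y = act g (act h y);
  act_continuous : continuous (fun p : G * Y => act p.1 p.2)
}.

Section EquivariantCategory.
Variables (R : realType) (G : topologicalGroupType) (Y : topologicalType).
Variable a : continuous_action G Y.

Definition G_invariant (U : set Y) := forall g y, U y -> U (a g y).

(* A homotopy U x [0, 1] -> Y is a map on all of Y x R of which only the
   restriction to U x [0, 1] matters. *)
Definition equivariant_homotopy (U : set Y) (H : Y * R -> Y) :=
  {within U `*` `[0, 1]%classic, continuous H} /\
  (forall g y t, U y -> `[0, 1]%classic t -> a g (H (y, t)) = H (a g y, t)).

Definition G_categorical (U : set Y) :=
  exists H : Y * R -> Y,
    [/\ equivariant_homotopy U H,
        forall y, U y -> H (y, 0) = y &
        exists y0, forall y, U y -> exists g, H (y, 1) = a g y0].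

Definition has_G_categorical_cover (n : nat) :=
  exists U : 'I_n -> set Y,
    (forall i, [/\ open (U i), G_invariant (U i) & G_categorical (U i)]) /\
    \bigcup_i U i = [set: Y].

(* The definition does not need G to be compact or Y to be Hausdorff; these
   hold for the action considered here, see [Z2pow_compact], [RZ_hausdorff]. *)
Definition equivariant_cat : \bar nat :=
  match pselect (exists n, `[< (0 < n)%N /\ has_G_categorical_cover n >]) with
  | left ex_cover => (ex_minn ex_cover)%:E
  | right _ => +oo%E
  end.

End EquivariantCategory.
Arguments equivariant_cat R {G Y} a.

Section SimplicialComplex.
Variable r : nat.

(* The vertex i of [r] may be a ghost vertex, that is, [set i] need not be a
   simplex. *)
Definition simplicial_complex (K : {set {set 'I_r}}) :=
  finset.set0 \in K /\
  forall s t : {set 'I_r}, s \in K -> t \subset s -> t \in K.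

Definition maximal_simplices (K : {set {set 'I_r}}) : {set {set 'I_r}} :=
  [set s | maxset (mem K) s]%SET.

End SimplicialComplex.

(* The group law of ['Z_2] as a [groupType] is addition modulo 2, so in [Z2pow]
   the product (g * h)%g is pointwise addition; the topology is discrete. *)
Definition Z2pow (r : nat) := {ffun 'I_r -> 'Z_2}.

HB.instance Definition _ r := Finite.on (Z2pow r).
HB.instance Definition _ r := Group.on (Z2pow r).
HB.instance Definition _ r := hasNbhs.Build (Z2pow r) principal_filter.
HB.instance Definition _ r := Discrete_ofNbhs.Build (Z2pow r) erefl.

Lemma Z2pow_mulg_continuous r :
  continuous (fun p : Z2pow r * Z2pow r => (p.1 * p.2)%g).
Proof.
move=> [g h] B /principal_filterP Bgh.
exists ([set g], [set h]); first by split; exact: discrete_set1.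
by move=> [g' h'] [/= -> ->].
Qed.

Lemma Z2pow_invg_continuous r : continuous (fun g : Z2pow r => g^-1%g).
Proof. by move=> g B /principal_filterP Bg; apply/principal_filterP. Qed.

HB.instance Definition _ r := isTopologicalGroup.Build (Z2pow r)
  (@Z2pow_mulg_continuous r) (@Z2pow_invg_continuous r).

Lemma Z2pow_compact r : compact [set: Z2pow r].
Proof. exact/finite_compact/finite_finset. Qed.

Section RealMomentAngle.
Variables (R : realType) (r : nat).

Definition D1 : set R := `[-1, 1]%classic.
Definition S0 : set R := [set -1; 1].

Definition D1S0 (s : {set 'I_r}) : set 'rV[R]_r :=
  [set x | forall i, D1 (x 0 i) /\ (i \notin s -> S0 (x 0 i))].

Definition real_moment_angle (K : {set {set 'I_r}}) : set 'rV[R]_r :=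
  \bigcup_(s in [set` K]) D1S0 s.

Definition sign (e : 'Z_2) : R := (-1) ^+ (e : nat).

Definition flip (g : Z2pow r) (x : 'rV[R]_r) : 'rV[R]_r :=
  \row_i (sign (g i) * x 0 i).

Lemma sign0 : sign 0 = 1. Proof. exact: expr0. Qed.

Lemma signM (e f : 'Z_2) : sign (e * f)%g = sign e * sign f.
Proof.
case: e f => [[|[|//]] ?] [[|[|//]] ?]; rewrite /sign /= ?(expr0, expr1) ?mul1r //.
- by rewrite mulr1.
- by rewrite mulrNN mulr1.
Qed.

Lemma sign_cases (e : 'Z_2) : sign e = 1 \/ sign e = -1.
Proof. by case: e => [[|[|//]] ?]; [left|right]. Qed.

Lemma flip1 x : flip 1%g x = x.
Proof. by apply/rowP => i; rewrite mxE ffunE sign0 mul1r. Qed.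

Lemma flipM g h x : flip (g * h)%g x = flip g (flip h x).
Proof. by apply/rowP => i; rewrite !mxE ffunE signM mulrA. Qed.

Lemma flip_real_moment_angle K g x :
  real_moment_angle K x -> real_moment_angle K (flip g x).
Proof.
move=> [s Ks xs]; exists s => // i; rewrite mxE.
have [] := xs i; rewrite /D1 /S0 /= !in_itv /= => /andP[x1 x2] xS.
case: (sign_cases (g i)) => ->; rewrite ?mul1r ?mulN1r.
  by rewrite x1 x2.
rewrite lerN2 lerNl x1 x2; split=> // /xS [->|->]; rewrite ?opprK; [by right|by left].
Qed.

Variable K : {set {set 'I_r}}.

(* [set_type] carries the subspace topology. *)
Definition RZ : topologicalType := set_type (real_moment_angle K).

Lemma RZ_hausdorff : hausdorff_space RZ.
Proof.
move=> x y xy; apply: val_inj; apply/rowP => i.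
have coord_cont : continuous (fun z : RZ => set_val z 0 i).
  move=> z.
  apply: (@continuous_comp RZ _ _ set_val (fun x : 'rV[R]_r => x 0 i)).
    exact: initial_continuous.
  exact: coord_continuous.
apply: (@Rhausdorff R) => A B Ax By.
have [z [/= ? ?]] := xy _ _ (coord_cont x _ Ax) (coord_cont y _ By).
by exists (set_val z 0 i).
Qed.

Definition RZ_flip (g : Z2pow r) (x : RZ) : RZ :=
  exist _ (flip g (set_val x))
    (mem_set (flip_real_moment_angle g (set_valP x))).

Lemma RZ_flip1 x : RZ_flip 1%g x = x.
Proof. by apply: val_inj; exact: flip1. Qed.

Lemma RZ_flipM g h x : RZ_flip (g * h)%g x = RZ_flip g (RZ_flip h x).
Proof. by apply: val_inj; exact: flipM. Qed.

Lemma RZ_flip_continuous :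
  continuous (fun p : Z2pow r * RZ => RZ_flip p.1 p.2).
Proof.
apply: continuous_comp_initial => -[g x] B [P xP PB].
pose Q (j : 'I_1) i := (fun t => sign (g i) * t) @^-1` P j i.
pose V := [set y : 'rV[R]_r | forall j i, Q j i (y j i)].
have xV : nbhs (set_val x) V.
  exists Q => // j i; apply: mulrl_continuous.
  by have := xP j i; rewrite mxE ord1.
exists ([set g], set_val @^-1` V).
  split; first exact: discrete_set1.
  exact: initial_continuous xV.
move=> [h y] [/= -> Vy]; apply: PB => j i; rewrite mxE ord1.
exact: Vy.
Qed.

Definition RZ_action : continuous_action (Z2pow r) RZ :=
  Build_continuous_action RZ_flip1 RZ_flipM RZ_flip_continuous.

End RealMomentAngle.

(* Main.v *)
(** Lower bound: an equivariant homotopy can only enlarge isotropy groups, i.e.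
    the set of vanishing coordinates of a point.  A point whose vanishing
    coordinates form a maximal simplex [s] therefore keeps exactly this
    vanishing set, which is an invariant of the orbit; so a categorical set
    contains such points for at most one [s].

    Upper bound: for a maximal simplex [s], the open set where no coordinate
    outside [s] vanishes deforms to an orbit by pushing the coordinates outside
    [s] to their signs and then shrinking those in [s] to 0. *)
Require Import Defs.
From mathcomp Require Import all_boot all_order all_algebra.
From mathcomp Require Import all_classical all_reals all_analysis.
From mathcomp Require Import lra.
Set Implicit Arguments.
Unset Strict Implicit.
Unset Printing Implicit Defensive.
Import Order.TTheory GRing.Theory Num.Theory.
Import numFieldNormedType.Exports.
Local Open Scope classical_set_scope.
Local Open Scope ring_scope.

Lemma equivariant_catE (R : realType) (G : topologicalGroupType)
    (Y : topologicalType) (a : continuous_action G Y) (n : nat) :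
  (0 < n)%N -> has_G_categorical_cover R a n ->
  (forall m, has_G_categorical_cover R a m -> (n <= m)%N) ->
  equivariant_cat R a = n%:E.
Proof.
move=> n0 an nmin; rewrite /equivariant_cat.
case: pselect => [ex|[]]; last first.
  by exists n; apply/asboolP.
case: ex_minnP => m /asboolP[m0 am] mmin; congr (_%:E); apply/eqP.
by rewrite eqn_leq nmin // mmin //; apply/asboolP.
Qed.

Lemma row_continuous (R : realType) (T : topologicalType) (n : nat)
    (f : T -> 'rV[R]_n) (x : T) :
  (forall i, {for x, continuous (fun y => f y 0 i)}) -> {for x, continuous f}.
Proof.
move=> fx B [P xP PB].
have : \forall y \near x, forall i, P 0 i (f y 0 i).
  by apply: filter_forall => i; apply: fx; exact: xP.
by apply: filterS => y Py; apply: PB => j i; rewrite ord1; exact: Py.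
Qed.

Section RealMomentAngleCategory.
Variables (R : realType) (r : nat).
Implicit Types (s t : {set 'I_r}) (K : {set {set 'I_r}}).

Lemma sign_neq0 (e : 'Z_2) : sign R e != 0.
Proof. by case: (sign_cases R e) => ->; rewrite ?oppr_eq0 oner_neq0. Qed.

Lemma normr_sign (e : 'Z_2) : `|sign R e| = 1.
Proof. by case: (sign_cases R e) => ->; rewrite ?normrN normr1. Qed.

Lemma maximal_simplices_exists K s :
  s \in K -> exists2 t, t \in maximal_simplices K & s \subset t.
Proof. by case/maxset_exists => t tK st; exists t => //; rewrite inE. Qed.

Lemma maximal_simplices_sub K s : s \in maximal_simplices K -> s \in K.
Proof. by rewrite inE => /maxsetP[]. Qed.

(** * Vanishing coordinates and isotropy groups *)

Definition vanishing (x : 'rV[R]_r) : {set 'I_r} := [set i | x 0 i == 0]%SET.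

Lemma vanishing_flip g x : vanishing (flip g x) = vanishing x.
Proof.
by apply/setP => i; rewrite !inE mxE mulf_eq0 (negbTE (sign_neq0 _)).
Qed.

(** The isotropy group of [x] contains the single flip at each vanishing coordinate; if that flip
    fixes [y], then [- y 0 i = y 0 i]. *)
Lemma vanishing_isotropy (x y : 'rV[R]_r) :
  (forall g, flip g x = x -> flip g y = y) -> vanishing x \subset vanishing y.
Proof.
move=> xy; apply/fintype.subsetP => i; rewrite !inE => /eqP xi0.
pose g : Z2pow r := [ffun j => if j == i then 1 else 0].
have /xy /rowP/(_ i) : flip g x = x.
  apply/rowP => j; rewrite mxE ffunE; case: eqP => [->|_].
    by rewrite xi0 mulr0.
  by rewrite sign0 mul1r.
rewrite mxE ffunE eqxx /sign /= expr1 => yi.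
by apply/eqP; lra.
Qed.

Lemma vanishing_real_moment_angle K x :
  real_moment_angle K x -> exists2 s, s \in K & vanishing x \subset s.
Proof.
move=> [s Ks xs]; exists s => //; apply/fintype.subsetP => i.
rewrite inE => /eqP xi0; apply/negPn/negP => /(proj2 (xs i)).
by rewrite /S0 /= xi0 => -[]; lra.
Qed.

(** Serves both as the test point for [s] in the lower bound and as the base point of the orbit in
    the upper bound. *)
Definition center s : 'rV[R]_r := \row_i (if i \in s then 0 else 1).

Lemma vanishing_center s : vanishing (center s) = s.
Proof.
by apply/setP => i; rewrite inE mxE; case: (i \in s); rewrite ?eqxx ?oner_eq0.
Qed.

Lemma center_real_moment_angle K s : s \in K -> real_moment_angle K (center s).
Proof.
move=> sK; exists s => // i; rewrite mxE /D1 /S0 /= in_itv /=.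
by case: (i \in s); split=> //; [lra|lra|right].
Qed.

(** The vanishing set of [y] contains [s] by isotropy and lies in some simplex [t]; maximality
    forces [t = s]. *)
Lemma vanishing_maximal K s (x y : RZ R K) : s \in maximal_simplices K ->
  vanishing (set_val x) = s ->
  (forall g, RZ_flip g x = x -> RZ_flip g y = y) ->
  vanishing (set_val y) = s.
Proof.
rewrite inE => /maxsetP[_ smax] xs xy.
have sy : s \subset vanishing (set_val y).
  rewrite -xs; apply: vanishing_isotropy => g gx.
  by have /(congr1 set_val) : RZ_flip g y = y by apply/xy/val_inj.
have [t tK yt] := vanishing_real_moment_angle (set_valP y).
have ts : t = s by apply: smax => //; exact: fintype.subset_trans yt.
by apply/eqP; rewrite finset.eqEsubset sy -{1}ts yt.
Qed.

(** * The lower bound *)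

Lemma leq_card_maximal_simplices K n :
  has_G_categorical_cover R (RZ_action R K) n ->
  (#|maximal_simplices K| <= n)%N.
Proof.
move=> [U [Ucat Ucover]].
(* The choice function is defined on all sets, and ['I_n] may be empty, so [None] serves as the
   value off the maximal simplices. *)
have /choice[c cP] (s : {set 'I_r}) : exists i : option 'I_n,
    s \in maximal_simplices K ->
    exists i' (x : RZ R K),
      [/\ i = Some i', U i' x & vanishing (set_val x) = s].
  have [sm|] := boolP (s \in maximal_simplices K); last by exists None.
  have sK := maximal_simplices_sub sm.
  pose x : RZ R K := exist _ (center s) (mem_set (center_real_moment_angle sK)).
  have [i _ Uix] : (\bigcup_i U i) x by rewrite Ucover.
  by exists (Some i) => _; exists i, x; split => //; exact: vanishing_center.
have orbit_vanishing i : exists v, forall s x, s \in maximal_simplices K ->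
    U i x -> vanishing (set_val x) = s -> s = v.
  have [_ _ [H [[_ Heq] H0 [y0 Hy0]]]] := Ucat i.
  exists (vanishing (set_val y0)) => s x sm Ux xs.
  have [g Hg] := Hy0 _ Ux.
  rewrite -(vanishing_flip g (set_val y0)).
  have <- : set_val (H (x, 1)) = flip g (set_val y0) by rewrite Hg.
  (* If [h] fixes [x], equivariance gives [h H(x, 1) = H(h x, 1) = H(x, 1)]. *)
  apply/esym/(vanishing_maximal sm xs) => h hx.
  have /= -> := Heq h x 1 Ux; first by rewrite hx.
  by rewrite /= in_itv /= ler01 lexx.
have cinj : {in maximal_simplices K &, injective c}.
  move=> s t sm tm.
  have [i [x [-> Uix xs]]] := cP _ sm; have [j [y [-> Ujy yt]]] := cP _ tm.
  move=> [ij]; move: Ujy; rewrite -ij => Uiy.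
  have [v vP] := orbit_vanishing i.
  by rewrite (vP _ _ sm Uix xs) (vP _ _ tm Uiy yt).
rewrite -(card_in_imset cinj).
(* Comparing with the image of [Some] instead of all of [option 'I_n] avoids counting [None]. *)
rewrite -[leqRHS]card_ord -cardsT -(card_imset [set: 'I_n]%SET (@Some_inj _)).
apply: fintype.subset_leq_card; apply/fintype.subsetP => _ /imsetP[s sm ->].
by have [i [x [-> _ _]]] := cP _ sm; apply/imsetP; exists i; rewrite ?inE.
Qed.

(** * The upper bound *)

(* Up to time 1/2 every coordinate equal to 1 or -1 stays put, and from then on
   all those outside [s] are 1 or -1: the point thus never leaves the complex. *)
Definition deform s (x : 'rV[R]_r) (u : R) : 'rV[R]_r :=
  \row_i if i \in s then x 0 i * Num.min 1 (2 - 2 * u)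
         else x 0 i / `|x 0 i| * Num.min 1 (`|x 0 i| + 2 * u).

Definition star K s : set (RZ R K) :=
  [set x : RZ R K | forall i, i \notin s -> set_val x 0 i != 0].
Arguments star : clear implicits.

Lemma deform0 s x : D1S0 [set: 'I_r]%SET x -> deform s x 0 = x.
Proof.
move=> x1; apply/rowP => i; have [+ _] := x1 i; rewrite mxE /D1 /= in_itv /=.
rewrite mulr0 addr0 subr0 -ler_norml => xi1.
case: ifP => _; first by rewrite min_l ?mulr1 //; lra.
rewrite min_r //; have [->|xi0] := eqVneq (x 0 i) 0; first by rewrite !mul0r.
by rewrite divfK // normr_eq0.
Qed.

(** In both branches the coordinate is an odd function of [x 0 i], since otherwise only [|x 0 i|]
    enters. *)
Lemma deform_flip s g x u : deform s (flip g x) u = flip g (deform s x u).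
Proof.
apply/rowP => i; rewrite !mxE normrM normr_sign mul1r.
by case: ifP; rewrite !mulrA.
Qed.

Lemma deform1 s (x : 'rV[R]_r) : (forall i, i \notin s -> x 0 i != 0) ->
  exists g, deform s x 1 = flip g (center s).
Proof.
(* At time 1 the coordinates in [s] are 0 and the others are the signs of [x], which [g] records. *)
move=> xs; exists [ffun i => if x 0 i < 0 then 1 else 0].
apply/rowP => i; rewrite !mxE ffunE; case: ifPn => [_|/xs xi0].
  by rewrite mulr0 mulr1 subrr min_r ?mulr0.
rewrite min_l; last by have := normr_ge0 (x 0 i); lra.
rewrite !mulr1; case: ltP => xi.
  by rewrite ltr0_norm // invrN mulrN divff //.
by rewrite ger0_norm // divff // sign0.
Qed.

Lemma D1_deform s x u : D1S0 [set: 'I_r]%SET x -> 0 <= u <= 1 ->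
  forall i, D1 (deform s x u 0 i).
Proof.
move=> x1 /andP[u0 u1] i; have [+ _] := x1 i.
rewrite mxE /D1 /= !in_itv /= -!ler_norml => xi1.
case: ifP => _; rewrite normrM.
  by rewrite mulr_ile1 // ger0_norm ?le_min ?ge_min ?ler01 ?lexx //; lra.
have ? := normr_ge0 (x 0 i).
have m0 : 0 <= Num.min 1 (`|x 0 i| + 2 * u) by rewrite le_min ler01; lra.
rewrite mulr_ile1 // ?(ger0_norm m0) ?ge_min ?lexx //.
rewrite normrM normfV normr_id.
have [->|xi0] := eqVneq `|x 0 i| 0; first by rewrite mul0r.
by rewrite divff.
Qed.

Lemma S0_norm (z : R) : S0 z <-> `|z| = 1.
Proof.
split=> [[->|->]|/eqP]; rewrite ?normrN ?normr1 //.
by rewrite eqr_norml ler01 andbT => /orP[/eqP ->|/eqP ->]; [right|left].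
Qed.

Lemma D1S0_subT s x : D1S0 s x -> D1S0 (R := R) [set: 'I_r]%SET x.
Proof. by move=> xs i; split; [have [] := xs i|rewrite inE]. Qed.

Lemma deform_real_moment_angle K s (x : 'rV[R]_r) u :
  s \in K -> real_moment_angle K x ->
  (forall i, i \notin s -> x 0 i != 0) -> 0 <= u <= 1 ->
  real_moment_angle K (deform s x u).
Proof.
move=> sK [t tK xt] xs u01; have x1 := D1S0_subT xt.
(* For [u <= 1 / 2] the factor [2 - 2 * u] is at least 1, so the simplex [t] of [x] still works;
   afterwards [2 * u > 1] saturates the other minimum and [s] works. *)
have [uh|uh] := leP u (1 / 2).
- exists t => // i; split; first exact: D1_deform.
  move=> it; have /S0_norm xi := (xt i).2 it; apply/S0_norm.
  case/andP: u01 => u0 u1.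
  rewrite mxE xi; case: ifP => _.
    by rewrite min_l ?mulr1 //; lra.
  by rewrite min_l ?mulr1 ?invr1 ?mulr1 //; lra.
- exists s => // i; split; first exact: D1_deform.
  move=> si; apply/S0_norm; rewrite mxE (negbTE si) min_l.
    by rewrite mulr1 normrM normfV normr_id divff // normr_eq0 xs.
  by have := normr_ge0 (x 0 i); lra.
Qed.

Lemma coord_continuous_RZ K i : continuous (fun x : RZ R K => set_val x 0 i).
Proof.
move=> x; apply: (@continuous_comp _ _ _ set_val (fun y : 'rV[R]_r => y 0 i)).
  exact: initial_continuous.
exact: coord_continuous.
Qed.

Lemma open_star K s : open (star K s).
Proof.
rewrite openE => x xs.
suff : \forall y \near x,
  forall i, i \notin s -> set_val (y : RZ R K) 0 i != 0 by [].
apply: (@filter_forall _ _ _ (nbhs x)) => i.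
have [is_|/xs xi0] := boolP (i \in s); first by apply: nearW => y.
have := @coord_continuous_RZ K i x _
  (open_nbhs_nbhs (conj (@open_neq _ 0) xi0)).
by apply: (@filterS _ (nbhs x)) => y.
Qed.

Lemma star_flip K s g x : star K s x -> star K s (RZ_flip g x).
Proof. by move=> xs i /xs xi0; rewrite mxE mulf_neq0 ?sign_neq0. Qed.

(** The quotient [x 0 i / |x 0 i|] is discontinuous only at 0, and it occurs only for [i] outside
    [s], where the star excludes 0. *)
Lemma deform_continuous K s x u : star K s x ->
  {for (x, u), continuous (fun p : RZ R K * R => deform s (set_val p.1) p.2)}.
Proof.
move=> xs; apply: row_continuous => i.
rewrite (_ : (fun _ => _) = (fun p : RZ R K * R => if i \in s
  then set_val p.1 0 i * Num.min 1 (2 - 2 * p.2)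
  else set_val p.1 0 i / `|set_val p.1 0 i|
       * Num.min 1 (`|set_val p.1 0 i| + 2 * p.2))); last first.
  by apply/funext => p; rewrite mxE.
have xc : {for (x, u), continuous (fun p : RZ R K * R => set_val p.1 0 i)}.
  apply: (@continuous_comp _ _ _ fst (fun y : RZ R K => set_val y 0 i)).
    exact: cvg_fst.
  exact: coord_continuous_RZ.
have uc : {for (x, u), continuous (fun p : RZ R K * R => 2 * p.2)}.
  by apply: cvgM; [exact: cvg_cst|exact: cvg_snd].
have nc : {for (x, u), continuous (fun p : RZ R K * R => `|set_val p.1 0 i|)}.
  by apply: cvg_norm; exact: xc.
have min1c (f : RZ R K * R -> R) : {for (x, u), continuous f} ->
    {for (x, u), continuous (fun p => Num.min 1 (f p))}.
  by move=> fc; exact: (continuous_min (@cst_continuous _ R^o 1 (x, u)) fc).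
have [_|/xs xi0] := boolP (i \in s).
  apply: cvgM; [exact: xc|apply: min1c].
  by apply: cvgB; [exact: cvg_cst|exact: uc].
apply: cvgM; last by apply: min1c; apply: cvgD; [exact: nc|exact: uc].
by apply: cvgM; [exact: xc|apply: cvgV; [rewrite normr_eq0|exact: nc]].
Qed.

Lemma star_categorical K s :
  s \in K -> G_categorical R (RZ_action R K) (star K s).
Proof.
move=> sK.
(* [H] must be total: [insubd] returns [p.1] if the deformed point leaves the complex, which [HE]
   rules out over the star for times in [[0, 1]]. *)
pose H (p : RZ R K * R) : RZ R K := insubd p.1 (deform s (set_val p.1) p.2).
have HE x u : star K s x -> 0 <= u <= 1 ->
    set_val (H (x, u)) = deform s (set_val x) u.
  move=> xs u01; apply: insubdK; apply: mem_set.
  exact: deform_real_moment_angle (set_valP x) xs u01.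
have D1x (x : RZ R K) : D1S0 [set: 'I_r]%SET (set_val x).
  by have [t _ /D1S0_subT] := set_valP x.
exists H; split; [split|..].
(* Continuity into the subspace topology is tested after [set_val], where [H] agrees with [deform]
   on the domain. *)
- apply: continuous_comp_initial.
  apply: (@subspace_eq_continuous _ _ _
    (fun p : RZ R K * R => deform s (set_val p.1) p.2)).
    move=> [x u]; rewrite inE => -[/= xs]; rewrite in_itv /= => u01.
    by rewrite /from_subspace /= HE.
  apply: continuous_in_subspaceT => -[x u]; rewrite inE => -[/= xs _].
  exact: deform_continuous.
- move=> g x u xs; rewrite /= in_itv /= => u01; apply: val_inj => /=.
  transitivity (flip g (set_val (H (x, u)))); first by [].
  by rewrite HE // -deform_flip; apply/esym/HE; first exact: star_flip.
- move=> x xs; apply: val_inj; rewrite [LHS]HE ?lexx ?ler01 //.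
  exact: deform0.
- exists (exist _ (center s) (mem_set (center_real_moment_angle sK))) => x xs.
  have [g gE] := deform1 xs; exists g; apply: val_inj.
  by rewrite [LHS]HE ?lexx ?ler01.
Qed.

(** The vanishing set of a point lies in a simplex, hence in a maximal one, whose star then contains
    the point. *)
Lemma maximal_simplices_cover K :
  has_G_categorical_cover R (RZ_action R K) #|maximal_simplices K|.
Proof.
exists (fun i => star K (enum_val i)); split=> [i|].
  have sK := maximal_simplices_sub (enum_valP i).
  split; [exact: open_star|by move=> g x; exact: star_flip|].
  exact: star_categorical.
apply/seteqP; split=> // x _.
have [t tK xt] := vanishing_real_moment_angle (set_valP x).
have [s sm ts] := maximal_simplices_exists tK.
exists (enum_rank_in sm s) => // i; rewrite enum_rankK_in //.
apply: contraNneq => xi0; apply: (fintype.subsetP ts).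
by apply: (fintype.subsetP xt); rewrite inE xi0.
Qed.

End RealMomentAngleCategory.

Theorem theorem3p9 (R : realType) (r : nat) (K : {set {set 'I_r}})
    (simplK : simplicial_complex K) :
  equivariant_cat R (RZ_action R K) = (#|maximal_simplices K|)%:E.
Proof.
apply: equivariant_catE; last exact: leq_card_maximal_simplices.
  (* The empty simplex extends to a maximal one, so the count is positive. *)
  have [s sm _] := maximal_simplices_exists (proj1 simplK).
  by apply/card_gt0P; exists s.
exact: maximal_simplices_cover.
Qed.
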